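(* Let $n\ge 1$ and $m$ be integers with $0\le m\le \binom{n}{2}$, and let $f(n,m)$ denote the maximum of $\sum_{u\in V(G)} d^2(u)$ over all simple graphs $G$ with $n$ vertices and $m$ edges, where $d(u)$ is the degree of $u$. If $m\ge n(n-1)/4$, then \[ m\sqrt{8m+1}-3m\le f(n,m)\le m\sqrt{8m+1}-m. \] Moreover, if in addition $m<(n-1)(n-2)/2$, then \[ m\sqrt{8m+1}-m< m\left(\frac{2m}{n-1}+n-2\right). \]
   Context: Graphs are finite and simple; $f(n,m)$ is the maximum sum of squares of degrees over graphs with $n$ vertices and $m$ edges. The quantity $D(n,m)=m\left(\frac{2m}{n-1}+n-2\right)$ is de Caen's upper bound on $f(n,m)$. *)

(* Defs.v *)
From HB Require Import structures.
From mathcomp Require Import all_boot all_order all_algebra.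

Set Implicit Arguments.
Unset Strict Implicit.
Unset Printing Implicit Defensive.

(* A finite simple graph on the labelled vertex set 'I_n is given by its edge
   set: a set of two-element subsets of 'I_n (no loops, no multiple edges). *)
Definition simple_graph (n : nat) (E : {set {set 'I_n}}) : bool :=
  [forall e in E, #|e| == 2].

Definition degree (n : nat) (E : {set {set 'I_n}}) (u : 'I_n) : nat :=
  #|[set e in E | u \in e]|.

(* For m <= 'C(n, 2) the range is nonempty, so this is a genuine maximum; for
   larger m it is the default value 0 of an empty \max. *)
Definition max_sum_sq_degrees (n m : nat) : nat :=
  \max_(E : {set {set 'I_n}} | simple_graph E && (#|E| == m))
     \sum_(u < n) degree E u ^ 2.

(* Main.v *)
(** Write [q x = x (sqrt (8 x + 1) - 1)].  In a graph maximizing the sum of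
    squares of degrees, replacing an edge [yz] by a non-edge [xz] with
    [degree y <= degree x] would increase the sum; hence a vertex of minimum
    degree is isolated, or each of its neighbours is adjacent to every other
    vertex.  Deleting an isolated or universal vertex gives, by induction and
    for every number [m] of edges, that the sum is at most [q m] or at most the
    bound [cobound] that [q] yields through the complementary graph; the
    latter is the smaller one as soon as [m] is at least half of [C(n, 2)].
    The lower bound comes from a clique on [j] vertices plus one vertex joined
    to part of it, where [C(j, 2) <= m <= C(j + 1, 2)].  With [k = n - 1] and
    [s = sqrt (8 m + 1)], de Caen's bound minus [q m] equals
    [m ((s - 2 k)^2 - 1) / (4 k)], which is positive for [s < 2 k - 1]. *)

Require Import Defs.
From HB Require Import structures.
From mathcomp Require Import all_boot all_order all_algebra.
From mathcomp Require Import ring lra zify.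

Set Implicit Arguments.
Unset Strict Implicit.
Unset Printing Implicit Defensive.
Import Order.TTheory GRing.Theory Num.Theory.

(** * Extremal graphs: edge switching, vertex deletion, and a near-clique *)

Section Graphs.
Variable n : nat.
Implicit Types (E : {set {set 'I_n}}) (A V S : {set 'I_n}).

Definition pairs A := [set e : {set 'I_n} | (e \subset A) && (#|e| == 2)].

Definition sum_sq E := \sum_(u < n) degree E u ^ 2.

Lemma degreeE E u : degree E u = \sum_(e in E) (u \in e).
Proof.
by rewrite /degree -sum1dep_card big_mkcondr; apply: eq_bigr => e _; case: ifP.
Qed.

Lemma pairsP A (e : {set 'I_n}) y : e \in pairs A -> y \in e ->
  exists z, [/\ z \in A, z != y & e = [set y; z]].
Proof.
rewrite inE => /andP[/subsetP eA /cards2P[a [b [ab ee]]]].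
rewrite {}ee in eA *; rewrite !inE => /orP[]/eqP->; [exists b|exists a].
  by rewrite eA ?set22 // eq_sym.
by rewrite eA ?set21 // setUC.
Qed.

Lemma pair_in_pairs A x y :
  ([set x; y] \in pairs A) = [&& x \in A, y \in A & x != y].
Proof. by rewrite inE cards2 subUset !sub1set -andbA; case: (x != y). Qed.

Lemma pair_inj (z : 'I_n) : injective (fun w => [set z; w]).
Proof.
move=> a b E; have /set2P[az|//] : a \in [set z; b] by rewrite -E set22.
by have /set2P[->|->] : b \in [set z; a] by rewrite E set22.
Qed.

Lemma handshake A E : E \subset pairs A -> \sum_(u < n) degree E u = 2 * #|E|.
Proof.
move=> /subsetP EA; under eq_bigr do rewrite degreeE.
rewrite exchange_big /= mulnC -sum_nat_const.
apply: eq_bigr => e /EA; rewrite inE => /andP[_ /eqP<-].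
by rewrite -sum1_card [RHS]big_mkcond; apply: eq_bigr => u _; case: ifP.
Qed.

Lemma card_pairs A : #|pairs A| = 'C(#|A|, 2).
Proof. exact: cards_draws. Qed.

Lemma degree_out A E u : E \subset pairs A -> u \notin A -> degree E u = 0.
Proof.
move=> /subsetP EA uA; rewrite degreeE big1 // => e /EA.
rewrite inE => /andP[/subsetP eA _]; case ue: (u \in e) => //.
by rewrite eA in uA.
Qed.

Lemma degree_universal A E z : E \subset pairs A -> z \in A ->
  (forall w, w \in A -> w != z -> [set z; w] \in E) -> degree E z = #|A|.-1.
Proof.
move=> /subsetP EA zA zE.
rewrite (cardsD1 z A) zA /= -(card_imset _ (@pair_inj z)).
apply: eq_card => e; rewrite inE; apply/andP/imsetP => [[eE ze]|[w]].
  by have [w [wA wz ->]] := pairsP (EA _ eE) ze; exists w; rewrite // !inE wz.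
by rewrite !inE => /andP[wz wA] ->; rewrite set21 zE.
Qed.

(* Moving the edge [y z] to [x z] changes the sum of squares by
   [2 (degree E x - degree E y + 1)]. *)
Lemma switch_edge E x y z : x != y -> x != z -> y != z ->
    [set y; z] \in E -> [set x; z] \notin E ->
    degree E y <= degree E x ->
  let E' := [set x; z] |: (E :\ [set y; z]) in
  #|E'| = #|E| /\ sum_sq E < sum_sq E'.
Proof.
move=> xy xz yz yzE xzE dxy E'; have xzE' : [set x; z] \notin E :\ [set y; z].
  by rewrite inE negb_and xzE orbT.
split; first by rewrite cardsU1 xzE' (cardsD1 [set y; z] E) yzE.
have dE u : degree E' u + (u == y) = degree E u + (u == x).
  rewrite !degreeE /E' big_setU1 //= [in RHS](big_setD1 _ yzE) /= !inE.
  set t := \sum_(_ in _) _.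
  case: (eqVneq u x) => [->|ux]; first by rewrite ?eqxx (negPf xy) (negPf xz) /=; lia.
  case: (eqVneq u y) => [->|uy]; first by rewrite ?eqxx (negPf yz) /=; lia.
  by case: eqVneq; lia.
have dx' := dE x; rewrite eqxx (negPf xy) addn0 in dx'.
have dy' := dE y; rewrite eqxx eq_sym (negPf xy) addn0 in dy'.
have rest : \sum_(i < n | (i != x) && (i != y)) degree E' i ^ 2 =
            \sum_(i < n | (i != x) && (i != y)) degree E i ^ 2.
  apply: eq_bigr => u /andP[ux uy].
  by have := dE u; rewrite (negPf ux) (negPf uy) !addn0 => ->.
have yx : y != x by rewrite eq_sym.
rewrite /sum_sq !(bigD1 x isT) /= !(bigD1 y yx) /= rest dx' -dy' !addnA.
rewrite ltn_add2r; move: dxy; rewrite -dy'.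
by move: (degree E x) (degree E' y) => a b ab; rewrite !addn1 in ab *; nia.
Qed.

Lemma extremal_structure A E : E \subset pairs A -> A != set0 ->
    (forall E', E' \subset pairs A -> #|E'| = #|E| -> sum_sq E' <= sum_sq E) ->
  (exists2 y, y \in A & E \subset pairs (A :\ y)) \/
  (exists2 z, z \in A & forall w, w \in A -> w != z -> [set z; w] \in E).
Proof.
move=> EA /set0Pn[y0 y0A] Emax.
have EAP e : e \in E -> e \in pairs A by apply/subsetP: e.
(* For [y] of minimum degree with a neighbour [z], any [w] not adjacent to [z] has degree at least
   that of [y], so switching [[y z]] to [[w z]] would contradict maximality. *)
case: (@arg_minnP _ y0 (mem A) (degree E) y0A) => y yA ymin.
case: (pickP (fun e => (e \in E) && (y \in e))) => [e /andP[eE ye]|iso].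
  right; have [z [zA zy ee]] := pairsP (EAP _ eE) ye; rewrite {}ee in eE ye.
  exists z => // w wA wz; rewrite setUC; case: (eqVneq w y) => [->//|wy].
  apply: contraT => wzE; rewrite eq_sym in zy.
  have [cE lt] := switch_edge wy wz zy eE wzE (ymin w wA).
  move: lt; rewrite ltnNge Emax //; apply/subsetP => e'.
  rewrite !inE => /orP[/eqP->|/andP[_ /EAP]]; last by rewrite inE.
  by have := pair_in_pairs A w z; rewrite wA zA wz inE => ->.
left; exists y => //; apply/subsetP => e eE; have := EAP _ eE; rewrite !inE.
rewrite subsetD1 => /andP[-> ->]; have := iso e; rewrite eE /= => ->.
by [].
Qed.

(** The vertex [z] accounts for [k ^ 2]. The [k] other vertices of [A] each lose one from their
    degree, and the handshake identity in [E'] turns the sum of [2 d + 1] over them into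
    [4 * #|E'| + k]. *)
Lemma universal_removal A E z : E \subset pairs A -> z \in A ->
    (forall w, w \in A -> w != z -> [set z; w] \in E) ->
  let k := #|A|.-1 in
  exists E', [/\ E' \subset pairs (A :\ z), #|E| = #|E'| + k &
    sum_sq E = sum_sq E' + 4 * #|E'| + k * k.+1].
Proof.
move=> EA zA zE k; have dz := degree_universal EA zA zE.
pose E' := [set e in E | z \notin e]; exists E'.
have E'A : E' \subset pairs (A :\ z).
  apply/subsetP => e; rewrite !inE subsetD1 => /andP[/(subsetP EA)].
  by rewrite inE => /andP[-> ->] ->.
have kE : #|A :\ z| = k by rewrite /k (cardsD1 z A) zA.
have cE : #|E| = #|E'| + k.
  rewrite -(cardsID [set e : {set 'I_n} | z \in e] E) addnC; congr (_ + _).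
    by apply: eq_card => e; rewrite !inE andbC.
  by rewrite /k -dz; apply: eq_card => e; rewrite !inE andbC.
have dE u : u != z -> degree E u = degree E' u + (u \in A).
  move=> uz; rewrite !degreeE (bigID (fun e : {set 'I_n} => z \in e)) /= addnC.
  congr (_ + _); first by apply: eq_bigl => e; rewrite !inE.
  case uA: (u \in A).
    rewrite (bigD1 [set z; u]) /=; last by rewrite zE // set21.
    rewrite set22 big1 // => e /andP[/andP[eE ze] ne].
    case ue: (u \in e) => //; have [w [_ wz ee]] := pairsP (subsetP EA _ eE) ze.
    move: ue ne; rewrite ee !inE (negPf uz) /= => /eqP->.
    by rewrite eqxx.
  rewrite big1 // => e /andP[/(subsetP EA) + _]; rewrite inE => /andP[eA _].
  by case ue: (u \in e) => //; rewrite (subsetP eA) in uA.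
split=> //.
have hs := handshake E'A; rewrite (bigD1 z) //= in hs.
rewrite /sum_sq (bigD1 z) //= [in RHS](bigD1 z) //= dz -/k.
have z0 : degree E' z = 0 by apply: (degree_out E'A); rewrite !inE eqxx.
rewrite z0 in hs *.
have -> : \sum_(u < n | u != z) degree E u ^ 2 =
  \sum_(u < n | u != z) degree E' u ^ 2 + 2 * \sum_(u < n | u != z) degree E' u
  + \sum_(u < n | u != z) (u \in A).
  rewrite big_distrr -!big_split /=; apply: eq_bigr => u uz.
  rewrite dE //; case: (boolP (u \in A)) => uA /=; first nia.
  by rewrite (degree_out E'A) // inE (negPf uA) andbF.
have -> : \sum_(u < n | u != z) (u \in A) = k.
  rewrite -kE -sum1_card [RHS]big_mkcond [LHS]big_mkcond; apply: eq_bigr => u _.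
  by rewrite !inE; case: (u != z) => //=; case: (u \in A).
move: hs; rewrite add0n => ->; rewrite exp0n // add0n -mulnn mulnS.
by move: (\sum_(_ < _ | _) _) => p; lia.
Qed.

(** Only the vertices of the clique are counted: with [j = #|V|], each gives at least [(j - 1) ^ 2],
    and those in [S] give [2 (j - 1)] more, which adds up to [2 (j - 1) ('C(j, 2) + #|S|)]. *)
Lemma clique_plus_vertex V S v : v \notin V -> S \subset V ->
  exists E, [/\ simple_graph E, #|E| = 'C(#|V|, 2) + #|S| &
    2 * #|E| * #|V|.-1 <= sum_sq E].
Proof.
move=> vV SV; have vS : v \notin S by apply: contra vV; apply: subsetP.
pose star := [set [set v; i] | i in S].
have dis : [disjoint pairs V & star].
  apply/pred0P => e /=; apply: contraTF (vV) => /andP[eV /imsetP[i _ ee]].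
  by move: eV; rewrite ee pair_in_pairs negbK => /and3P[].
have cE : #|pairs V :|: star| = 'C(#|V|, 2) + #|S|.
  rewrite cardsU (eqP (_ : pairs V :&: star == set0)) ?setI_eq0 // cards0 subn0.
  by rewrite card_pairs card_imset //; apply: pair_inj.
exists (pairs V :|: star); split=> //.
  apply/forallP => e; apply/implyP; rewrite !inE.
  case/orP => [/andP[]//|/imsetP[i iS ->]]; rewrite cards2.
  by rewrite (_ : v != i) //; apply: contra vS => /eqP->.
have dE u : degree (pairs V :|: star) u =
    (u \in V) * #|V|.-1 + (u == v) * #|S| + (u \in S).
  rewrite degreeE (eq_bigl (mem [predU pairs V & star])); last first.
    by move=> e; rewrite inE.
  rewrite bigU //= -addnA; congr (_ + _).
    rewrite -degreeE; case: (boolP (u \in V)) => uV; last first.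
      exact: degree_out uV.
    rewrite mul1n; apply: (degree_universal _ uV) => // w wV wu.
    by rewrite pair_in_pairs uV wV eq_sym.
  rewrite big_imset /=; last by move=> ? ? _ _; apply: pair_inj.
  case: (eqVneq u v) => [->|uv].
    rewrite (negPf vS) addn0 mul1n -sum1_card; apply: eq_bigr => i _.
    by rewrite set21.
  rewrite mul0n add0n; case: (boolP (u \in S)) => uS.
    rewrite (bigD1 u) //= set22 big1 // => i /andP[_ iu].
    by rewrite !inE (negPf uv) eq_sym (negPf iu).
  rewrite big1 // => i iS; rewrite !inE (negPf uv) /=.
  by case: eqVneq => // ui; rewrite ui iS in uS.
have le : \sum_(u < n) ((u \in V) * #|V|.-1 ^ 2 + (u \in S) * (2 * #|V|.-1))
    <= sum_sq (pairs V :|: star).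
  apply: leq_sum => u _; rewrite dE.
  case: (boolP (u \in V)) (subsetP SV u) => [uV _|uV sv].
    by case: (eqVneq u v) uV vV => [->->//|_ _ _]; case: (u \in S); nia.
  by case: (boolP (u \in S)) sv => // _ /(_ isT).
apply: leq_trans le; rewrite cE big_split -!big_distrl /=.
have sumI (B : {set 'I_n}) : \sum_(u < n) (u \in B) = #|B|.
  by rewrite -sum1_card [RHS]big_mkcond; apply: eq_bigr => u _; case: ifP.
rewrite !sumI -mulnn; have := bin_ffact #|V| 2.
rewrite ffactnS ffactn1 (_ : 2`! = 2) // mulnA => <-.
by rewrite [2 * _]mulnC mulnDl mulnDl [#|S| * (2 * _)]mulnA.
Qed.

End Graphs.

Local Open Scope ring_scope.

(** * Inequalities between the two real bounds *)

Section RealBounds.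
Variable R : rcfType.
Implicit Types x y k m : R.

Definition qbound x := x * (Num.sqrt (8 * x + 1) - 1).

(** The number of pairs among [k + 1] vertices, for real [k]. *)
Definition triang k := k * (k + 1) / 2.

(* If the complement of a graph on [k + 1] vertices with [m] edges satisfies
   the bound [qbound], then the graph itself satisfies this one. *)
Definition cobound k m := qbound (triang k - m) + 2 * k * (2 * m - triang k).

(** Taking the square root as the variable makes the inequalities below polynomial. *)
Lemma qbound_root x : 0 <= x -> exists s, [/\ 1 <= s, Num.sqrt (8 * x + 1) = s,
  x = (s ^+ 2 - 1) / 8 & qbound x = (s ^+ 2 - 1) * (s - 1) / 8].
Proof.
move=> x0; exists (Num.sqrt (8 * x + 1)).
have h : x = (Num.sqrt (8 * x + 1) ^+ 2 - 1) / 8 by rewrite sqr_sqrtr; lra.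
split => //; last by rewrite /qbound {1}h mulrAC.
by rewrite -[leLHS]sqrtr1 ler_wsqrtr //; lra.
Qed.

(** Let [a] and [b] be the square roots for [m] and for the complement, and [N = 2 k + 1]. Then
    [a^2 + b^2 = N^2 + 1], and the difference of the bounds is [(a - b) (N - a) (N - b) / 8], where
    [b <= a <= N]. *)
Lemma cobound_le_qbound k m : 0 <= k -> triang k / 2 <= m -> m <= triang k ->
  cobound k m <= qbound m.
Proof.
move=> k0 lem mle; have M0 : 0 <= triang k by rewrite /triang; nra.
have [|a [a1 _ am qa]] := @qbound_root m; first by lra.
have [|b [b1 _ bm qb]] := @qbound_root (triang k - m); first by lra.
rewrite /cobound qa qb.
have eM : triang k = (a ^+ 2 + b ^+ 2 - 2) / 8 by lra.
have eN : a ^+ 2 + b ^+ 2 = (2 * k + 1) ^+ 2 + 1 by rewrite /triang in eM; lra.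
have ba : b <= a by nra.
have aN : a <= 2 * k + 1 by nra.
have key : 0 <= (a - b) * ((2 * k + 1 - a) * (2 * k + 1 - b)).
  by rewrite !mulr_ge0 //; lra.
rewrite -subr_ge0 eM am.
have -> : (a ^+ 2 - 1) * (a - 1) / 8 - ((b ^+ 2 - 1) * (b - 1) / 8 +
   2 * k * (2 * ((a ^+ 2 - 1) / 8) - (a ^+ 2 + b ^+ 2 - 2) / 8))
   = (a - b) * ((2 * k + 1 - a) * (2 * k + 1 - b)) / 8
     + (a - b) * (a ^+ 2 + b ^+ 2 - ((2 * k + 1) ^+ 2 + 1)) / 8 by field.
by rewrite eN subrr mulr0 mul0r addr0 divr_ge0.
Qed.

(* With [s] and [r] the square roots in [qbound x] and [qbound (x + k)], and
   [u = r - s], [v = r + s], so that [u v = 8 k], the difference of both sides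
   is [(4 - u) (u - 2) (v^2 - 2 u - 4) / 64]. *)
Lemma qbound_shift k x : 1 <= k -> k * (k - 1) / 4 <= x ->
  x <= k * (k - 1) / 2 -> 4 * x + k * (k + 1) <= qbound (x + k) - qbound x.
Proof.
move=> k1 lex xle; have x0 : 0 <= x by nra.
have [|s [s1 _ sx ->]] := @qbound_root x; first by lra.
have [|r [r1 _ rx ->]] := @qbound_root (x + k); first by lra.
have ek : k = (r - s) * (r + s) / 8 by nra.
(* The range of [x] gives [k <= s <= 2 k - 1]. As [r^2 = s^2 + 8 k], it follows that [r <= s + 4]
   and [r <= 2 k + 1]; the latter bounds [r + s] by [4 k], so that [r - s >= 2]. *)
have sk : k <= s by nra.
have sk2 : s <= 2 * k - 1 by nra.
have r3 : 3 <= r by nra.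
have rs : s <= r by nra.
have rk : r <= 2 * k + 1 by nra.
have u2 : 2 <= r - s by nra.
have u4 : r - s <= 4 by nra.
have v4 : 2 * (r - s) + 4 <= (r + s) ^+ 2 by nra.
rewrite -subr_ge0 sx ek.
have -> : (r ^+ 2 - 1) * (r - 1) / 8 - (s ^+ 2 - 1) * (s - 1) / 8 -
   (4 * ((s ^+ 2 - 1) / 8) + (r - s) * (r + s) / 8 *
     ((r - s) * (r + s) / 8 + 1))
  = (4 - (r - s)) * (r - s - 2) * ((r + s) ^+ 2 - 2 * (r - s) - 4) / 64.
  by field.
by rewrite divr_ge0 // !mulr_ge0 //; lra.
Qed.

(** This handles adding an isolated vertex: the complement gains [k + 1] edges, and below half of
    the pairs [qbound_shift] applies to the number of edges of the complement. *)
Lemma cobound_step k m : 0 <= k -> 0 <= m -> m <= triang k ->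
  cobound k m <= qbound m \/ cobound k m <= cobound (k + 1) m.
Proof.
move=> k0 m0 mle; have [mM|mM] := lerP (triang k / 2) m.
  by left; apply: cobound_le_qbound.
right; have := @qbound_shift (k + 1) (triang k - m).
have -> : triang k - m + (k + 1) = triang (k + 1) - m by rewrite /triang; field.
rewrite /cobound; set a := qbound (_ (k + 1) - m); set b := qbound _ => H.
have {H} : 4 * (triang k - m) + (k + 1) * (k + 1 + 1) <= a - b.
  by apply: H; rewrite /triang in mle mM *; lra.
rewrite /triang; lra.
Qed.

Lemma triang_step k : triang (k + 1) = triang k + (k + 1).
Proof. by rewrite /triang; field. Qed.

(** A universal vertex leaves the number of edges of the complement unchanged, so the [qbound] terms
    agree; the increment is exactly that of [universal_removal]. *)
Lemma cobound_dominating k m :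
  cobound (k + 1) (m + (k + 1)) = cobound k m + 4 * m + (k + 1) * (k + 2).
Proof.
rewrite /cobound.
have -> : triang (k + 1) - (m + (k + 1)) = triang k - m.
  by rewrite triang_step; ring.
by set q := qbound _; rewrite /triang; field.
Qed.

(* [cobound_step] read in the complementary graph. *)
Lemma qbound_dominating k m : 0 <= k -> 0 <= m -> m <= triang k ->
  qbound m + 4 * m + (k + 1) * (k + 2) <= qbound (m + (k + 1)) \/
  qbound m + 4 * m + (k + 1) * (k + 2) <= cobound (k + 1) (m + (k + 1)).
Proof.
move=> k0 m0 mle.
have [||H|H] := @cobound_step k (triang k - m) k0; [lra|lra|right|left].
  rewrite cobound_dominating !lerD2r; move: H; rewrite /cobound subKr; lra.
move: H; rewrite /cobound triang_step subKr.
have -> : triang k + (k + 1) - (triang k - m) = m + (k + 1) by ring.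
rewrite /triang; lra.
Qed.

End RealBounds.

(** * The upper bound for a single graph, by induction on its vertices *)

Lemma bin2_triang (R : rcfType) k : 'C(k.+1, 2)%:R = triang k%:R :> R.
Proof.
have : ('C(k.+1, 2) * 2)%:R = (k.+1 * k)%:R :> R.
  by have := bin_ffact k.+1 2; rewrite ffactnS ffactn1 => <-.
by rewrite !natrM -[k.+1]addn1 natrD /triang; lra.
Qed.

Lemma card_le_triang (R : rcfType) n k (A : {set 'I_n}) (E : {set {set 'I_n}}) :
  #|A| = k.+1 -> E \subset pairs A -> #|E|%:R <= triang k%:R :> R.
Proof.
by move=> cA /subset_leq_card; rewrite card_pairs cA -bin2_triang ler_nat.
Qed.

(** Both bounds are carried along because deleting a vertex may move the number of edges across half
    of the pairs. The set [A] of remaining vertices shrinks while the type ['I_n] stays fixed. *)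
Lemma sum_sq_bound (R : rcfType) n k (A : {set 'I_n}) (E : {set {set 'I_n}}) :
    #|A| = k.+1 -> E \subset pairs A ->
  (sum_sq E)%:R <= qbound #|E|%:R :> R \/
  (sum_sq E)%:R <= cobound k%:R #|E|%:R :> R.
Proof.
elim: k A E => [|k IH] A E cA EA.
  have E0 : E = set0.
    apply/eqP; rewrite -subset0; apply: subset_trans EA _; rewrite subset0.
    by rewrite -cards_eq0 card_pairs cA.
  left; rewrite /sum_sq big1; first by rewrite E0 cards0 /qbound mul0r.
  by move=> u _; rewrite degreeE E0 big_set0.
(* Both bounds depend on [E] only through [#|E|], so [E] may be replaced by a maximizer. *)
wlog Emax : E EA / forall E' : {set {set 'I_n}}, E' \subset pairs A ->
    #|E'| = #|E| -> (sum_sq E' <= sum_sq E)%N.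
  move=> H; pose Q := [pred E' : {set {set 'I_n}} |
    (E' \subset pairs A) && (#|E'| == #|E|)].
  have QE : Q E by rewrite /= EA eqxx.
  case: (@arg_maxnP _ E Q (@sum_sq n) QE) => E1 /andP[E1A /eqP c1] max1.
  have le : (sum_sq E)%:R <= (sum_sq E1)%:R :> R by rewrite ler_nat; apply: max1.
  rewrite -c1; case: (H E1 E1A) => [E' E'A c'|le1|le1].
  - by apply: max1; rewrite /= E'A c' c1 eqxx.
  - by left; apply: le_trans le le1.
  - by right; apply: le_trans le le1.
have k0 : 0 <= k%:R :> R by [].
have ksucc : k.+1%:R = k%:R + 1 :> R by rewrite -addn1 natrD.
have cAD y : y \in A -> #|A :\ y| = k.+1.
  by move=> yA; have := cardsD1 y A; rewrite yA cA => -[].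
have A0 : A != set0 by rewrite -cards_eq0 cA.
have [[y yA Ey]|[z zA zE]] := extremal_structure EA A0 Emax.
  have mle := card_le_triang R (cAD _ yA) Ey.
  have [le|le] := IH _ _ (cAD _ yA) Ey; first by left.
  rewrite ksucc; have [H|H] := cobound_step k0 (ler0n R _) mle.
    by left; apply: le_trans le H.
  by right; apply: le_trans le H.
have [E' [E'A cE sE]] := universal_removal EA zA zE.
have mle := card_le_triang R (cAD _ zA) E'A.
rewrite cA /= in cE sE; rewrite cE natrD ksucc.
have {sE} -> : (sum_sq E)%:R =
    (sum_sq E')%:R + 4 * #|E'|%:R + (k%:R + 1) * (k%:R + 2) :> R.
  by rewrite sE -ksucc -natrD addn2 -!natrM -!natrD.
have [le|le] := IH _ _ (cAD _ zA) E'A; last first.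
  by right; rewrite cobound_dominating !lerD2r.
have le' := lerD (lerD le (lexx (4 * #|E'|%:R))) (lexx ((k%:R + 1) * (k%:R + 2))).
have [H|H] := qbound_dominating k0 (ler0n R _) mle.
  by left; apply: le_trans le' H.
by right; apply: le_trans le' H.
Qed.

(** * The bounds on the maximum and the comparison with de Caen's bound *)

Lemma card_ord_ltn n j : (j <= n)%N -> #|[set i : 'I_n | (i < j)%N]| = j.
Proof.
by move=> jn; rewrite -sum1dep_card (big_ord_narrow jn) sum1_card card_ord.
Qed.

Lemma bin2_bracket k m : (m <= 'C(k.+1, 2))%N ->
  exists2 j, (j <= k)%N & ('C(j, 2) <= m <= 'C(j.+1, 2))%N.
Proof.
elim: k => [|k IH] mk; first by exists 0%N; rewrite // bin0n.
have [/IH[j jk h]|lt] := leqP m 'C(k.+1, 2); first by exists j; rewrite // leqW.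
by exists k.+1; rewrite // mk ltnW.
Qed.

(** The near-clique has sum at least [2 m (j - 1)], while [m <= 'C(j + 1, 2)] bounds the square root
    by [2 j + 1]. *)
Lemma max_sum_sq_degrees_ge (R : rcfType) k m : (m <= 'C(k.+1, 2))%N ->
  m%:R * Num.sqrt (8 * m%:R + 1) - 3 * m%:R <= (max_sum_sq_degrees k.+1 m)%:R :> R.
Proof.
case/bin2_bracket=> j jk /andP[jm mj].
pose t := (m - 'C(j, 2))%N; have tj : (t <= j)%N.
  by rewrite leq_subLR; move: mj; rewrite binS bin1.
pose V := [set i : 'I_k.+1 | (i < j)%N]; pose S := [set i : 'I_k.+1 | (i < t)%N].
have cV : #|V| = j by rewrite card_ord_ltn // leqW.
have cS : #|S| = t by rewrite card_ord_ltn // (leq_trans tj) // leqW.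
have [||E [sE cE le]] := @clique_plus_vertex _ V S (Ordinal (jk : (j < k.+1)%N)).
- by rewrite inE ltnn.
- by apply/subsetP => i; rewrite !inE => /leq_trans; apply.
rewrite cV cS subnKC // in cE; rewrite cV cE in le.
have {le} : (2 * m * j.-1 <= max_sum_sq_degrees k.+1 m)%N.
  apply: leq_trans le _; rewrite /max_sum_sq_degrees.
  by apply: (leq_bigmax_cond (F := @sum_sq _)); rewrite sE cE eqxx.
rewrite -(ler_nat R); apply: le_trans.
have hR : m%:R <= triang j%:R :> R by rewrite -bin2_triang ler_nat.
have j0 : 0 <= j%:R :> R by [].
have s_le : Num.sqrt (8 * m%:R + 1) <= 2 * j%:R + 1 :> R.
  have -> : 2 * j%:R + 1 = Num.sqrt ((2 * j%:R + 1) ^+ 2) :> R.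
    by rewrite sqrtr_sqr ger0_norm //; lra.
  by apply: ler_wsqrtr; rewrite /triang in hR; lra.
(* For [j = 0] the predecessor is truncated, but then [m = 0]. *)
case: (posnP j) mj => [->|jp _].
  by rewrite leqn0 => /eqP->; rewrite !mul0r mulr0 subr0.
have -> : (2 * m * j.-1)%:R = m%:R * (2 * j%:R - 2) :> R.
  rewrite -{2}(prednK jp) -[_.-1.+1]addn1 !natrM natrD; ring.
rewrite [3 * _]mulrC -mulrBr ler_wpM2l //; lra.
Qed.

Lemma max_sum_sq_degrees_le (R : rcfType) k m :
    triang k%:R / 2 <= m%:R :> R -> m%:R <= triang k%:R :> R ->
  (max_sum_sq_degrees k.+1 m)%:R <= qbound m%:R :> R.
Proof.
move=> lem mle; have k0 : 0 <= k%:R :> R by [].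
(* The first goal is the default value 0 of the maximum, whence the nonnegativity of [qbound]. *)
apply: (big_ind (fun x : nat => x%:R <= qbound m%:R :> R)) => [|x y hx hy|E].
- rewrite mulr_ge0 // subr_ge0 -[leLHS]sqrtr1 ler_wsqrtr //.
  by rewrite lerDr mulr_ge0.
- by rewrite /maxn; case: ifP.
case/andP=> /forallP sE /eqP cE; rewrite -cE in lem mle *.
have EA : E \subset pairs [set: 'I_k.+1].
  by apply/subsetP => e eE; rewrite inE subsetT (implyP (sE e)).
have cT : #|[set: 'I_k.+1]| = k.+1 by rewrite cardsT card_ord.
have [//|le] := sum_sq_bound R cT EA.
exact: le_trans le (cobound_le_qbound k0 lem mle).
Qed.

Theorem theorem1 (R : rcfType) (n m : nat)
    (n_ge1 : (1 <= n)%N) (m_le : (m <= 'C(n, 2))%N)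
    (m_ge : n%:R * (n%:R - 1) / 4 <= m%:R :> R) :
  (m%:R * Num.sqrt (8 * m%:R + 1) - 3 * m%:R <= (max_sum_sq_degrees n m)%:R :> R
   /\ (max_sum_sq_degrees n m)%:R <= m%:R * Num.sqrt (8 * m%:R + 1) - m%:R :> R)
  /\ (m%:R < (n%:R - 1) * (n%:R - 2) / 2 :> R ->
      m%:R * Num.sqrt (8 * m%:R + 1) - m%:R
        < m%:R * (2 * m%:R / (n%:R - 1) + n%:R - 2) :> R).
Proof.
case: n n_ge1 m_le m_ge => // k _ m_le; rewrite -[k.+1]addn1 natrD addrK addn1.
move=> m_ge; have k0 : 0 <= k%:R :> R by [].
have m0 : 0 <= m%:R :> R by [].
have mR : m%:R <= triang k%:R :> R by rewrite -bin2_triang ler_nat.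
split; first split; first exact: max_sum_sq_degrees_ge.
  have -> : m%:R * Num.sqrt (8 * m%:R + 1) - m%:R = qbound m%:R :> R.
    by rewrite /qbound mulrBr mulr1.
  by apply: max_sum_sq_degrees_le => //; rewrite /triang; lra.
(* Here [k (k + 1) / 4 <= m < k (k - 1) / 2] rules out small [k], in particular a zero
   denominator. *)
move=> m_lt; have k1 : 1 < k%:R :> R by nra.
have mp : 0 < m%:R :> R by nra.
have [s [s1 -> ms _]] := qbound_root m0.
(* The hypothesis on [m] reads [s^2 < (2 k - 1)^2]. *)
have sk : s < 2 * k%:R - 1 by nra.
rewrite -[X in _ - X]mulr1 -mulrBr ltr_pM2l //.
rewrite -subr_gt0 {}ms.
have -> : 2 * ((s ^+ 2 - 1) / 8) / k%:R + (k%:R + 1) - 2 - (s - 1) =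
    (2 * k%:R - 1 - s) * (2 * k%:R + 1 - s) / (4 * k%:R).
  by field; rewrite gt_eqF //; lra.
by rewrite divr_gt0 ?mulr_gt0 //; lra.
Qed.
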